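(* Let $m\ge 5$ and $n\le 2m-4$ be positive integers. Given any $n$ distinct angles $\theta_1,\dots,\theta_n\in(0,\pi)$, there is an arrangement of $m$ points in the plane $\mathbb{R}^2$ realising all $n$ of these angles. Moreover, these $m$ points may be chosen in convex position.
   Context: All angles are assumed to lie strictly between $0$ and $\pi$. A set of points realises an angle $\theta$ if there are points $A,B,C$ in the set such that $\angle ABC=\theta$ (the angle at $B$ between the rays $BA$ and $BC$). An arrangement of $m$ points is a set of $m$ distinct points. *)

(* Defs.v *)
From HB Require Import structures.
From mathcomp Require Import all_boot all_order all_algebra.
From mathcomp Require Import all_classical all_reals all_analysis.

Set Implicit Arguments.
Unset Strict Implicit.
Unset Printing Implicit Defensive.

Import Order.TTheory GRing.Theory Num.Theory.

Local Open Scope classical_set_scope.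
Local Open Scope ring_scope.

Definition dotv (R : realType) (u v : 'rV[R]_2) : R := (u *m v^T) 0 0.

(* The library's norm on row vectors is the sup norm, hence this one. *)
Definition enorm (R : realType) (u : 'rV[R]_2) : R := Num.sqrt (dotv u u).

(* The unoriented angle at B, in [0, pi]; meaningful only for A, C != B. *)
Definition angle (R : realType) (A B C : 'rV[R]_2) : R :=
  acos (dotv (A - B) (C - B) / (enorm (A - B) * enorm (C - B))).

(* A and C must differ from B for the rays BA and BC to exist. A = C is
   harmless: it only yields the angle 0. *)
Definition realises (R : realType) (S : set 'rV[R]_2) (theta : R) : Prop :=
  exists A B C : 'rV[R]_2,
    [/\ S A, S B, S C, A != B & C != B] /\ angle A B C = theta.

Definition convex_hull (R : realType) (S : set 'rV[R]_2) : set 'rV[R]_2 :=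
  smallest (@convex_set R 'rV[R]_2) S.

(* Strict convex position: every point of S is a vertex of the hull of S. *)
Definition convex_position (R : realType) (S : set 'rV[R]_2) : Prop :=
  forall p : 'rV[R]_2, S p -> ~ convex_hull (S `\ p) p.

(* Main.v *)
(* Sort the angles as t_0 < ... < t_(2L-1), with L = m - 2, after adding new
   ones if n < 2L. The points form a fan of L triangles 0 R_k R_(k+1) with
   common apex 0. Up to similarity the fan is determined by two angles for each
   triangle: R_0 0 R_(k+1), and the angle at R_k or at R_(k+1); this gives 2L
   angles in all. The fan is in convex position as soon as its angle at the apex
   is less than pi and, at each inner R_k, the angles of the two triangles meeting
   there have a sum less than pi; local convexity is made global by a
   Grassmann-Pluecker relation. The sorted angles can be distributed over the
   fan in this way unless t_0 + t_(L+1) >= pi. In that case t_(L-1) and t_(L+1)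
   are realised instead as the angles R_1 R_0 R_2 and R_1 0 R_3. *)

Require Import Defs.
From HB Require Import structures.
From mathcomp Require Import all_boot all_order all_algebra.
From mathcomp Require Import all_classical all_reals all_analysis.
From mathcomp Require Import ring lra zify.

Set Implicit Arguments.
Unset Strict Implicit.
Unset Printing Implicit Defensive.

Import Order.TTheory GRing.Theory Num.Theory.

Local Open Scope classical_set_scope.
Local Open Scope ring_scope.

(** * Orientation of triples and convex position *)

Section Orientation.
Context {R : realType}.
Implicit Types (a b p q s u : 'rV[R]_2) (V : nat -> 'rV[R]_2).

(** Twice the signed area of the triangle, positive for a counterclockwise turn. *)
Definition orient p q s : R :=
  (q 0 0 - p 0 0) * (s 0 1 - p 0 1) - (q 0 1 - p 0 1) * (s 0 0 - p 0 0).

Lemma orient_rot p q s : orient p q s = orient q s p.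
Proof. by rewrite /orient; ring. Qed.

Lemma orient_swap p q s : orient p q s = - orient q p s.
Proof. by rewrite /orient; ring. Qed.

Lemma orient_same p q : orient p q q = 0.
Proof. by rewrite /orient; ring. Qed.

Lemma convex_orient_ge0 p q : convex_set [set s | 0 <= orient p q s].
Proof.
move=> x y t; rewrite !inE /= => hx hy.
have -> : orient p q (conv t x y) =
    t%:num * orient p q x + (1 - t%:num) * orient p q y.
  by rewrite /orient /conv /= !mxE /unstable.onem; ring.
have t0 : 0 <= t%:num :> R by [].
have t1 : t%:num <= 1 :> R by [].
by rewrite addr_ge0 // mulr_ge0 // subr_ge0.
Qed.

(** All triples are required: left turns at consecutive vertices alone would let the chain wind
    round several times. *)
Definition convex_chain V m := forall i j k,
  (i < j)%N -> (j < k)%N -> (k < m)%N -> 0 < orient (V i) (V j) (V k).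

(** The line through the two cyclic neighbours of [V k] cuts it off from all the others. The
    neighbours wrap around at both ends of the chain, hence the three cases. *)
Lemma convex_chain_sep V m k : (2 < m)%N -> (k < m)%N -> convex_chain V m ->
  exists p q, orient p q (V k) < 0 /\
    forall j, (j < m)%N -> j <> k -> 0 <= orient p q (V j).
Proof.
move=> m3 km VC; case: (posnP k) => [k0|k0].
  exists (V m.-1), (V 1); split=> [|j jm jk].
    by rewrite k0 orient_rot orient_swap oppr_lt0; apply: VC; lia.
  rewrite orient_rot.
  have [->|j1] := eqVneq j 1.
    by rewrite orient_rot orient_rot orient_same.
  have [->|jm1] := eqVneq j m.-1; first by rewrite orient_same.
  by apply/ltW/VC; move/eqP in j1; move/eqP in jm1; lia.
have [km1|km1] := eqVneq k m.-1.
  exists (V k.-1), (V 0); split=> [|j jm jk].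
    by rewrite orient_swap oppr_lt0; apply: VC; lia.
  rewrite orient_rot.
  have [->|j1] := eqVneq j 0.
    by rewrite orient_rot orient_rot orient_same.
  have [->|jm1] := eqVneq j k.-1; first by rewrite orient_same.
  by apply/ltW/VC; move/eqP in j1; move/eqP in jm1; lia.
exists (V k.-1), (V k.+1); move/eqP in km1; split=> [|j jm jk].
  by rewrite orient_rot orient_swap oppr_lt0 -orient_rot; apply: VC; lia.
have [->|j1] := eqVneq j k.-1; first by rewrite orient_rot orient_same.
have [->|j2] := eqVneq j k.+1; first by rewrite orient_same.
move/eqP in j1; move/eqP in j2.
have [jk'|jk'] := ltnP j k.
  by rewrite -orient_rot; apply/ltW/VC; lia.
by apply/ltW/VC; lia.
Qed.

(** The separating line does both jobs: equal vertices would lie on both sides of it, and its closed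
    half-plane contains the hull of the other vertices but not [V k]. *)
Lemma convex_chain_position V m : (2 < m)%N -> convex_chain V m ->
  ([set V i | i in `I_m] #= `I_m)%card /\ convex_position [set V i | i in `I_m].
Proof.
move=> m3 VC; split.
  apply: inj_card_eq => i j; rewrite !inE /= => im jm Vij.
  have [//|/eqP ij] := eqVneq i j.
  have [p [q [neg nneg]]] := convex_chain_sep m3 im VC.
  have := nneg j jm (fun h => ij (esym h)).
  by rewrite -Vij leNgt neg.
move=> _ [k km <-] hull.
have [p [q [neg nneg]]] := convex_chain_sep m3 km VC.
have sub : [set V i | i in `I_m] `\ V k `<=` [set s | 0 <= orient p q s].
  move=> _ [[j jm <-] jk] /=.
  by apply: nneg => // jk'; apply: jk; rewrite jk'.
have := smallest_sub (@convex_orient_ge0 p q) sub hull.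
by rewrite /= leNgt neg.
Qed.

(* Both conclusions are the three-term Grassmann-Pluecker relation, with [b]
   respectively [c] as the common point. *)
Lemma orient_trans o a b c d :
    0 < orient o a b -> 0 < orient o a c -> 0 < orient o b c ->
    0 < orient o b d -> 0 < orient o c d ->
    0 < orient a b c -> 0 < orient b c d ->
  0 < orient a b d /\ 0 < orient a c d.
Proof.
move=> oab oac obc obd ocd abc bcd; split; rewrite -(pmulr_rgt0 _ obc).
  have -> : orient o b c * orient a b d =
      orient o a b * orient b c d + orient o b d * orient a b c.
    by rewrite /orient; ring.
  by rewrite addr_gt0 ?mulr_gt0.
have -> : orient o b c * orient a c d =
    orient o a c * orient b c d + orient o c d * orient a b c.
  by rewrite /orient; ring.
by rewrite addr_gt0 ?mulr_gt0.
Qed.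

(** Two inductions on [orient_trans] with [V 0] as base point: the first conclusion moves the last
    index away from [i, i+1], then the second moves the middle index away from [i]. *)
Lemma convex_chain_fan V m :
    (forall i j, (0 < i)%N -> (i < j)%N -> (j < m)%N ->
      0 < orient (V 0) (V i) (V j)) ->
    (forall i, (0 < i)%N -> (i.+2 < m)%N ->
      0 < orient (V i) (V i.+1) (V i.+2)) ->
  convex_chain V m.
Proof.
move=> fan loc.
have step d : forall i, (0 < i)%N -> (i.+2 + d < m)%N ->
    0 < orient (V i) (V i.+1) (V (i.+2 + d)%N).
  elim: d => [|d IH] i i0 im; first by move: im; rewrite addn0; apply: loc.
  have im' : (i.+3 + d < m)%N by lia.
  have [] := @orient_trans (V 0) (V i) (V i.+1) (V i.+2)
    (V (i.+2 + d.+1)%N) => //.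
  all: try by apply: fan; lia.
  - by apply: loc => //; lia.
  - by rewrite -addSnnS; apply: IH => //; lia.
have {}step i k : (0 < i)%N -> (i.+1 < k)%N -> (k < m)%N ->
    0 < orient (V i) (V i.+1) (V k).
  by move=> i0 ik km; rewrite -(subnKC ik); apply: step; rewrite ?subnKC.
move=> i j k; case: i => [|i] ij jk km; first exact: fan.
elim: j ij k jk km => // j IH ij k jk km.
have [ji|nij] := eqVneq i.+1 j.
  by rewrite -ji; apply: step => //; rewrite ji.
have ij' : (i.+1 < j)%N by move/eqP in nij; lia.
have [] := @orient_trans (V 0) (V i.+1) (V j) (V j.+1) (V k) => //.
all: try by apply: fan; lia.
- by apply: IH => //; lia.
- by apply: step => //; lia.
Qed.

End Orientation.

(** * Polar coordinates, and triangles with a vertex at the origin *)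

Section Polar.
Context {R : realType}.
Implicit Types (B : 'rV[R]_2) (S : set 'rV[R]_2) (r a b c : R).

Definition polar r a : 'rV[R]_2 :=
  \row_(j < 2) (r * (if j == 0 then cos a else sin a)).

Lemma polarE0 r a : polar r a 0 0 = r * cos a. Proof. by rewrite mxE. Qed.

Lemma polarE1 r a : polar r a 0 1 = r * sin a. Proof. by rewrite mxE. Qed.

Lemma row2P (u v : 'rV[R]_2) : u 0 0 = v 0 0 -> u 0 1 = v 0 1 -> u = v.
Proof.
move=> uv0 uv1; apply/rowP => j.
by case: j => [[|[|//]]] j2;
  [rewrite (_ : Ordinal j2 = 0) | rewrite (_ : Ordinal j2 = 1)];
  rewrite ?uv0 ?uv1 //; apply: val_inj.
Qed.

Lemma dotv_polar r a r' b :
  dotv (polar r a) (polar r' b) = r * r' * cos (a - b).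
Proof.
rewrite /dotv mxE big_ord_recl big_ord_recl big_ord0 addr0.
rewrite (_ : lift ord0 ord0 = 1); last exact: val_inj.
by rewrite !mxE /= cosB; ring.
Qed.

Lemma enorm_polar r a : 0 < r -> enorm (polar r a) = r.
Proof.
move=> r0; rewrite /enorm dotv_polar subrr cos0 mulr1 -expr2 sqrtr_sqr.
exact: gtr0_norm.
Qed.

Lemma polar_neq0 r a : 0 < r -> polar r a != 0.
Proof.
move=> r0; apply/eqP => h; have := enorm_polar a r0; rewrite h.
rewrite /enorm /dotv mul0mx mxE sqrtr0 => r0'.
by rewrite -r0' ltxx in r0.
Qed.

Lemma realises_polar S B r r' a b : 0 < r -> 0 < r' -> 0 <= b <= pi ->
    S B -> S (B + polar r a) -> S (B + polar r' (a + b)) ->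
  realises S b.
Proof.
move=> r0 r0' bpi SB Sa Sb.
exists (B + polar r (a)), B, (B + polar r' (a + b)); split.
  by split=> //; rewrite -subr_eq0 addrAC subrr add0r polar_neq0.
have subB u : B + u - B = u by rewrite addrAC subrr add0r.
rewrite /angle !subB dotv_polar !enorm_polar // opprD addrA subrr add0r cosN.
by rewrite mulrAC divff ?mul1r ?cosK ?mulf_neq0 ?gt_eqF //; rewrite in_itv.
Qed.

Lemma realises_apex S r r' a b : 0 < r -> 0 < r' -> 0 <= b - a <= pi ->
    S 0 -> S (polar r a) -> S (polar r' b) ->
  realises S (b - a).
Proof.
move=> r0 r0' ab S0 Sa Sb.
apply: (@realises_polar S 0 r r' a) => //; first by rewrite add0r.
by rewrite add0r addrC subrK.
Qed.

(* The law of sines: in the triangle with vertices [0], [polar r a] and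
   [polar r' b], it says that the angle at [polar r a] is [c]. *)
Definition sine_rule r r' a b c :=
  [/\ 0 < b - a, 0 < c, b - a + c < pi & r' * sin (b - a + c) = r * sin c].

Lemma sine_rule_gt0 r r' a b c : sine_rule r r' a b c ->
  [/\ 0 < sin (b - a), 0 < sin c & 0 < sin (b - a + c)].
Proof. by case=> ab c0 cpi _; split; apply: sin_gt0_pi; lra. Qed.

(** The third side of the triangle: its length comes from the law of sines, and its direction is
    that of the apex, [a + pi], turned clockwise by [c]. *)
Lemma polar_sine_rule r r' a b c : sine_rule r r' a b c ->
  polar r' b =
    polar r a + polar (r * sin (b - a) / sin (b - a + c)) (a + pi - c).
Proof.
move=> tri; have [_ _ s0] := sine_rule_gt0 tri; case: tri => _ _ _ rule.
have -> : r' = r * sin c / sin (b - a + c) by rewrite -rule mulfK // gt_eqF.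
have [d bE] : exists d, b = a + d by exists (b - a); rewrite addrC subrK.
have -> : b - a = d by rewrite bE addrC addKr.
rewrite bE.
have : sin (d + c) != 0 by rewrite gt_eqF // (_ : d = b - a) // bE addrC addKr.
rewrite sinD => sdc0.
have cE : cos (a + pi - c) = - cos (a - c) by rewrite addrAC cosDpi.
have sE : sin (a + pi - c) = - sin (a - c) by rewrite addrAC sinDpi.
apply: row2P; rewrite [RHS]mxE !(polarE0, polarE1, cE, sE).
  by rewrite cosD cosB; field.
by rewrite sinD sinB; field.
Qed.

Lemma realises_sine_rule S r r' a b c : 0 < r -> 0 < r' ->
    sine_rule r r' a b c -> S 0 -> S (polar r a) -> S (polar r' b) ->
  realises S c /\ realises S (pi - (b - a) - c).
Proof.
move=> r0 r0' tri S0 Sa Sb; have [s1 s2 s3] := sine_rule_gt0 tri.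
have bE := polar_sine_rule tri; case: tri => ab c0 cpi _.
set t := r * sin (b - a) / sin (b - a + c) in bE.
have t0 : 0 < t by rewrite divr_gt0 ?mulr_gt0.
have polarDpi x y : polar x (y + pi) = - polar x y.
  by apply: row2P; rewrite [RHS]mxE !(polarE0, polarE1) (cosDpi, sinDpi) mulrN.
split.
  apply: (@realises_polar S (polar r a) t r (a + pi - c)) => //; first by lra.
    by rewrite -bE.
  by rewrite subrK polarDpi subrr.
apply: (@realises_polar S (polar r' b) r' t (b - pi)) => //; first by lra.
  have -> : b = b - pi + pi by rewrite subrK.
  by rewrite polarDpi addrK addNr.
have -> : b - pi + (pi - (b - a) - c) = a - c by lra.
by rewrite bE (addrAC a) polarDpi addrNK.
Qed.

Lemma orient_polar r1 a1 r2 a2 r3 a3 :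
  orient (polar r1 a1) (polar r2 a2) (polar r3 a3) =
  r1 * r2 * sin (a2 - a1) + r2 * r3 * sin (a3 - a2) - r1 * r3 * sin (a3 - a1).
Proof. by rewrite /orient !(polarE0, polarE1) !sinB; ring. Qed.

Lemma orient0_polar r1 a1 r2 a2 :
  orient 0 (polar r1 a1) (polar r2 a2) = r1 * r2 * sin (a2 - a1).
Proof. by rewrite /orient !(polarE0, polarE1) !mxE !sinB; ring. Qed.

(** The two triangles have angles [pi - (a2 - a1) - c1] and [c2] at their common outer vertex; the
    last hypothesis says that the sum is less than pi. *)
Lemma orient_sine_rule r1 a1 r2 a2 r3 a3 c1 c2 :
    0 < r2 -> sine_rule r1 r2 a1 a2 c1 -> sine_rule r2 r3 a2 a3 c2 ->
    c2 < a2 - a1 + c1 ->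
  0 < orient (polar r1 a1) (polar r2 a2) (polar r3 a3).
Proof.
move=> r20 tri1 tri2 c21.
have [s1 sc1 _] := sine_rule_gt0 tri1; have [s2 sc2 s2c2] := sine_rule_gt0 tri2.
case: tri1 => a12 c10 cpi1 rule1; case: tri2 => a23 c20 cpi2 rule2.
have s12 : 0 < sin (a2 - a1 + c1 - c2) by apply: sin_gt0_pi; lra.
(* This factor clears the denominators when [r1] and [r3] are expressed by [r2]. What remains
   contains the sine of pi minus the total angle at the middle vertex. *)
rewrite -(pmulr_rgt0 _ (mulr_gt0 sc1 s2c2)) orient_polar.
have -> : sin c1 * sin (a3 - a2 + c2) * (r1 * r2 * sin (a2 - a1) +
      r2 * r3 * sin (a3 - a2) - r1 * r3 * sin (a3 - a1)) =
    r2 ^+ 2 * sin (a2 - a1) * sin (a3 - a2) * sin (a2 - a1 + c1 - c2).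
  transitivity (sin (a2 - a1) * (sin c1 * r1) * r2 * sin (a3 - a2 + c2) +
      r2 * sin (a3 - a2) * sin c1 * (r3 * sin (a3 - a2 + c2)) -
      (r1 * sin c1) * (r3 * sin (a3 - a2 + c2)) * sin (a3 - a1)); first by ring.
  rewrite [sin c1 * r1]mulrC -rule1 rule2.
  have -> : a3 - a1 = (a2 - a1) + (a3 - a2) by lra.
  have -> : sin c1 = sin (a2 - a1 + c1 - (a2 - a1)).
    by rewrite addrAC subrr add0r.
  move: (a2 - a1 + c1) (a2 - a1) (a3 - a2) => x d1 d2.
  by rewrite !sinB !sinD; ring.
by rewrite !mulr_gt0 // exprn_gt0.
Qed.

(** The first triangle is known only through its apex angle. Its angle at the middle vertex is still
    below [pi - (a2 - a1)], hence below [pi - c]. *)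
Lemma orient_sine_rule_le r1 a1 r2 a2 r3 a3 c :
    0 < r1 -> 0 < r2 -> sine_rule r2 r3 a2 a3 c ->
    c <= a2 - a1 -> a2 - a1 < pi ->
  0 < orient (polar r1 a1) (polar r2 a2) (polar r3 a3).
Proof.
move=> r10 r20 tri ca a12pi; have [s1 sc s2] := sine_rule_gt0 tri.
case: tri => a23 c0 cpi rule.
rewrite -(pmulr_rgt0 _ s2) orient_polar.
have -> : sin (a3 - a2 + c) * (r1 * r2 * sin (a2 - a1) +
      r2 * r3 * sin (a3 - a2) - r1 * r3 * sin (a3 - a1)) =
    r2 * sin (a3 - a2) * (r1 * sin (a2 - a1 - c) + r2 * sin c).
  transitivity (r1 * r2 * sin (a2 - a1) * sin (a3 - a2 + c) +
      r2 * (r3 * sin (a3 - a2 + c)) * sin (a3 - a2) -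
      r1 * (r3 * sin (a3 - a2 + c)) * sin (a3 - a1)); first by ring.
  rewrite rule; have -> : a3 - a1 = (a2 - a1) + (a3 - a2) by lra.
  by move: (a2 - a1) (a3 - a2) => d1 d2; rewrite sinB !sinD; ring.
have sd : 0 <= sin (a2 - a1 - c) by apply: sin_ge0_pi; lra.
by rewrite !mulr_gt0 // ltr_wpDl ?mulr_gt0 // mulr_ge0 // ltW.
Qed.

(** Both triangles have the side from the apex to the first point. Seen from that point, the other
    two lie in directions [a1 + pi - c] and [a1 + pi - s], a left turn by [c - s]. *)
Lemma orient_sine_rule2 r1 a1 r2 a2 r3 a3 c s :
    0 < r1 -> sine_rule r1 r2 a1 a2 c -> sine_rule r1 r3 a1 a3 s -> s < c ->
  0 < orient (polar r1 a1) (polar r2 a2) (polar r3 a3).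
Proof.
move=> r10 tric tris sc.
have [s1 sc0 s2] := sine_rule_gt0 tric; have [s3 ss s4] := sine_rule_gt0 tris.
case: tric => a12 c0 cpi rulec; case: tris => a13 s0 spi rules.
have scs : 0 < sin (c - s) by apply: sin_gt0_pi; lra.
rewrite -(pmulr_rgt0 _ (mulr_gt0 s2 s4)) orient_polar.
have -> : sin (a2 - a1 + c) * sin (a3 - a1 + s) * (r1 * r2 * sin (a2 - a1) +
      r2 * r3 * sin (a3 - a2) - r1 * r3 * sin (a3 - a1)) =
    r1 ^+ 2 * sin (a2 - a1) * sin (a3 - a1) * sin (c - s).
  transitivity (
      r1 * (r2 * sin (a2 - a1 + c)) * sin (a3 - a1 + s) * sin (a2 - a1) +
      (r2 * sin (a2 - a1 + c)) * (r3 * sin (a3 - a1 + s)) * sin (a3 - a2) -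
      r1 * (r3 * sin (a3 - a1 + s)) * sin (a2 - a1 + c) * sin (a3 - a1));
    first by ring.
  rewrite rulec rules; have -> : a3 - a2 = (a3 - a1) - (a2 - a1) by lra.
  by move: (a2 - a1) (a3 - a1) => d1 d2; rewrite !sinB !sinD; ring.
by rewrite !mulr_gt0 // exprn_gt0.
Qed.

Lemma realises_sine_rule2 S r1 a1 r2 a2 r3 a3 c s :
    0 < r1 -> sine_rule r1 r2 a1 a2 c -> sine_rule r1 r3 a1 a3 s -> s < c ->
    S (polar r1 a1) -> S (polar r2 a2) -> S (polar r3 a3) ->
  realises S (c - s).
Proof.
move=> r10 tric tris sc S1.
have [s1 _ s2] := sine_rule_gt0 tric; have [s3 _ s4] := sine_rule_gt0 tris.
rewrite (polar_sine_rule tric) (polar_sine_rule tris).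
case: tric => a12 c0 cpi _; case: tris => _ s0 _ _.
have cE : a1 + pi - s = a1 + pi - c + (c - s) by lra.
rewrite {}cE; apply: realises_polar => //; rewrite ?divr_gt0 ?mulr_gt0 //.
by lra.
Qed.

End Polar.

(** * Fans of triangles with prescribed angles *)

Section Fan.
Context {R : realType}.
Implicit Types (L : nat) (r a c t : nat -> R).

(** The apex has index 0, so R_k has index [k.+1]; [L] triangles have [L.+2] vertices. *)
Definition fan_vertex r a i : 'rV[R]_2 :=
  if i is k.+1 then polar (r k) (a k) else 0.

Definition fan L r a : set 'rV[R]_2 := [set fan_vertex r a i | i in `I_L.+2].

Lemma fan0 L r a : fan L r a 0. Proof. by exists 0. Qed.

Lemma fan_polar L r a k : (k <= L)%N -> fan L r a (polar (r k) (a k)).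
Proof. by exists k.+1. Qed.

Lemma step_lt_mono L a : (forall k, (k < L)%N -> a k < a k.+1) ->
  forall i j, (i < j)%N -> (j <= L)%N -> a i < a j.
Proof.
move=> step i; elim=> // j IH ij jL.
have [->|nij] := eqVneq i j; first exact: step.
by apply: lt_trans (step j jL); apply: IH; move/eqP in nij; lia.
Qed.

Lemma fan_convex L r a : (0 < L)%N ->
    (forall k, (k <= L)%N -> 0 < r k) ->
    (forall k, (k < L)%N -> a k < a k.+1) -> a L < a 0 + pi ->
    (forall k, (k.+2 <= L)%N -> 0 < orient (polar (r k) (a k))
      (polar (r k.+1) (a k.+1)) (polar (r k.+2) (a k.+2))) ->
  (fan L r a #= `I_L.+2)%card /\ convex_position (fan L r a).
Proof.
move=> L0 r0 astep aL loc.
have amono := step_lt_mono astep.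
apply: convex_chain_position => //; apply: convex_chain_fan.
  move=> [//|i] [//|j] _ ij jL /=; rewrite orient0_polar.
  rewrite !mulr_gt0 ?r0 //; try lia.
  apply: sin_gt0_pi; rewrite subr_gt0 amono //=.
  have a0i : a 0 <= a i by case: i ij => // i ij; rewrite ltW ?amono //; lia.
  have ajL : a j <= a L.
    have [->//|njL] := eqVneq j L.
    by rewrite ltW ?amono //; move/eqP in njL; lia.
  by lra.
by move=> [//|i] _ iL /=; apply: loc; lia.
Qed.

(* [c k] is the angle at the nearer vertex [polar (r k) (a k)] of the [k]-th
   triangle of the fan, which determines the fan up to scaling. *)
Lemma fan_of_angles L a c : (0 < L)%N -> a 0 = 0 ->
    (forall k, (k < L)%N -> a k < a k.+1) -> a L < pi ->
    (forall k, (k < L)%N -> 0 < c k < pi - (a k.+1 - a k)) ->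
    (forall k, (k.+1 < L)%N -> c k.+1 < a k.+1 - a k + c k) ->
  exists S : set 'rV[R]_2,
    [/\ (S #= `I_L.+2)%card, convex_position S &
      forall k, (k < L)%N -> [/\ realises S (a k.+1), realises S (c k)
        & realises S (pi - (a k.+1 - a k) - c k)]].
Proof.
move=> L0 a0 astep aL cbound cstep.
(* The scale is fixed by [r 0 = 1]; each factor is the ratio of consecutive radii imposed by the law
   of sines. *)
pose r k := \prod_(i < k) (sin (c i) / sin (a i.+1 - a i + c i)).
have sin0 k : (k < L)%N -> 0 < sin (c k) /\ 0 < sin (a k.+1 - a k + c k).
  move=> kL; have /andP[c0 cpi] := cbound _ kL; have := astep _ kL => h1.
  by split; apply: sin_gt0_pi; lra.
have r0 k : (k <= L)%N -> 0 < r k.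
  move=> kL; apply: prodr_gt0 => i _.
  by have [|s1 s2] := sin0 i; [have := ltn_ord i; lia | rewrite divr_gt0].
have tri k : (k < L)%N -> sine_rule (r k) (r k.+1) (a k) (a k.+1) (c k).
  move=> kL; have /andP[c0 cpi] := cbound _ kL.
  have := astep _ kL; have [_ s0] := sin0 k kL => h1; split; try lra.
  by rewrite /r big_ord_recr /= -mulrA mulfVK // gt_eqF.
have amono := step_lt_mono astep.
have [cardS convS] : (fan L r a #= `I_L.+2)%card /\ convex_position (fan L r a).
  apply: fan_convex => //; first by rewrite a0 add0r.
  by move=> k kL; apply: orient_sine_rule (tri k _) (tri k.+1 _) _ => //;
    [apply: r0 | | apply: cstep]; lia.
exists (fan L r a); split=> // k kL.
have [] := realises_sine_rule (r0 k _) (r0 k.+1 _) (tri k kL) (fan0 L r a)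
  (fan_polar r a _) (fan_polar r a _) => //; try exact: ltnW.
move=> rc rf; split=> //.
have := @realises_apex _ (fan L r a) (r 0) (r k.+1) (a 0) (a k.+1).
rewrite a0 subr0; apply; rewrite ?r0 //; first last.
- exact: fan_polar.
- by rewrite -[X in polar _ X]a0; apply: fan_polar.
- exact: fan0.
have := amono 0 k.+1 isT kL; rewrite a0 => /ltW ->.
have [->|nkL] := eqVneq k.+1 L; first exact: ltW.
by rewrite (ltW (lt_trans (amono k.+1 L _ _) aL)) //; move/eqP in nkL; lia.
Qed.

(* Here [c0] and [s] are the angles at the vertex R_0 from the apex to R_1 and
   to R_2, and only the later triangles are given by [c]. *)
Lemma fan_of_angles2 L a c (c0 s : R) : (3 <= L)%N -> a 0 = 0 ->
    (forall k, (k < L)%N -> a k < a k.+1) -> a L < pi ->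
    0 < s < c0 -> a 1 + c0 < pi -> a 2 + s < pi ->
    (forall k, (k.+2 < L)%N -> 0 < c k.+2 < pi - (a k.+3 - a k.+2)) ->
    c 2 <= a 2 - a 1 ->
    (forall k, (k.+3 < L)%N -> c k.+3 < a k.+3 - a k.+2 + c k.+2) ->
  exists S : set 'rV[R]_2,
    [/\ (S #= `I_L.+2)%card, convex_position S,
      [/\ realises S c0, realises S (c0 - s), realises S (a 3 - a 1)
        & realises S (a 2)] &
      forall k, (k.+2 < L)%N -> realises S (a k.+3) /\
        realises S (pi - (a k.+3 - a k.+2) - c k.+2)].
Proof.
move=> L3 a0 astep aL /andP[s0 sc0] ac0 as0 cbound c2 cstep.
have L0 : (0 < L)%N by apply: leq_trans L3.
have amono := step_lt_mono astep.
have a_pi k : (0 < k <= L)%N -> 0 < a k < pi.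
  move=> /andP[k0 kL]; rewrite -{1}a0 amono //=.
  have [->//|nkL] := eqVneq k L.
  by apply: lt_trans aL; rewrite amono // ltn_neqAle nkL.
have a1 : 0 < a 1 by rewrite -a0 astep.
have a12 : a 1 < a 2 by apply/astep/ltnW.
have a23 : a 2 < a 3 by apply: astep.
have /andP[_ a2pi] := a_pi 2 (ltnW L3).
have /andP[_ a3pi] := a_pi 3 L3.
(* R_1 and R_2 are both located from R_0, by [c0] and [s]; from R_2 on each radius determines the
   next. *)
pose r k := match k with 0 => 1 | 1 => sin c0 / sin (a 1 - a 0 + c0)
  | k'.+2 => sin s / sin (a 2 - a 0 + s) *
      \prod_(i < k') (sin (c i.+2) / sin (a i.+3 - a i.+2 + c i.+2))
  end.
have tri1 : sine_rule (r 0) (r 1) (a 0) (a 1) c0.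
  have sum_gt0 : 0 < sin (a 1 - a 0 + c0) by apply: sin_gt0_pi; lra.
  by split; rewrite ?mul1r ?divfK ?gt_eqF //; lra.
have tri2 : sine_rule (r 0) (r 2) (a 0) (a 2) s.
  have sum_gt0 : 0 < sin (a 2 - a 0 + s) by apply: sin_gt0_pi; lra.
  by split; rewrite ?mul1r /= ?big_ord0 ?mulr1 ?divfK ?gt_eqF //; lra.
have tri k : (k.+2 < L)%N ->
    sine_rule (r k.+2) (r k.+3) (a k.+2) (a k.+3) (c k.+2).
  move=> kL; have /andP[ck0 ckpi] := cbound _ kL; have ak := astep _ kL.
  have sum_gt0 : 0 < sin (a k.+3 - a k.+2 + c k.+2) by apply: sin_gt0_pi; lra.
  split; try lra.
  by rewrite /r big_ord_recr /= mulrA -mulrA divfK // gt_eqF.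
have r0 k : (k <= L)%N -> 0 < r k.
  elim: k => [//|[_ _|[_ _|k IH kL]]].
  - by have [_ h2 h3] := sine_rule_gt0 tri1; apply: divr_gt0.
  - have [_ h2 h3] := sine_rule_gt0 tri2.
    by rewrite /r big_ord0 mulr1; apply: divr_gt0.
  have [_ h2 h3] := sine_rule_gt0 (tri k kL); case: (tri k kL) => _ _ _ rule.
  by rewrite -(pmulr_lgt0 _ h3) rule mulr_gt0 // IH // ltnW.
clearbody r.
have [cardS convS] : (fan L r a #= `I_L.+2)%card /\ convex_position (fan L r a).
  apply: fan_convex => //; first by rewrite a0 add0r.
  (* Convexity at R_1 comes from [s < c0], at R_2 from the bound on [c 2], and beyond from
     [cstep]. *)
  move=> [|[|k]] kL.
  - by apply: orient_sine_rule2 tri1 tri2 _ => //; apply: r0.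
  - by apply: orient_sine_rule_le (r0 1 L0) (r0 2 (ltnW L3)) (tri 0 L3) c2 _;
      lra.
  - apply: orient_sine_rule (tri k (ltnW kL)) (tri k.+1 kL) (cstep k kL).
    exact: r0 _ (ltnW kL).
have Sk := @fan_polar L r a; have S0 := fan0 L r a.
have real_a k : (0 < k <= L)%N -> realises (fan L r a) (a k).
  move=> kL; have /andP[ak0 akpi] := a_pi k kL; case/andP: kL => _ kL.
  have := @realises_apex _ (fan L r a) (r 0) (r k) (a 0) (a k).
  rewrite a0 subr0; apply;
    [exact: r0|exact: r0|by rewrite !ltW|exact: S0| |exact: Sk].
  by rewrite -[X in polar _ X]a0; apply: Sk.
exists (fan L r a); split=> //.
  split.
  - by have [] := realises_sine_rule (r0 0 _) (r0 1 _) tri1 S0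
      (Sk 0 _) (Sk 1 _).
  - by apply: realises_sine_rule2 tri1 tri2 _ (Sk 0 _) (Sk 1 _) (Sk 2 _);
      rewrite ?r0 //; apply: ltnW.
  - by apply: realises_apex (r0 1 _) (r0 3 _) _ S0 (Sk 1 _) (Sk 3 _) => //; lra.
  - by apply: real_a; apply: ltnW.
move=> k kL; split; first exact: real_a.
by have [] := realises_sine_rule (r0 k.+2 (ltnW kL)) (r0 k.+3 kL) (tri k kL) S0
  (Sk k.+2 (ltnW kL)) (Sk k.+3 kL).
Qed.
End Fan.

(** * Distribution of the sorted angles over the fan *)

Section Cases.
Context {R : realType}.
Variables (L : nat) (t : nat -> R).
Hypothesis L3 : (3 <= L)%N.
Hypothesis t_gt0 : forall k, (k < 2 * L)%N -> 0 < t k.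
Hypothesis t_ltpi : forall k, (k < 2 * L)%N -> t k < pi.
Hypothesis t_mono : forall i j, (i < j)%N -> (j < 2 * L)%N -> t i < t j.

Let realisable := exists S : set 'rV[R]_2,
  [/\ (S #= `I_L.+2)%card, convex_position S &
    forall k, (k < 2 * L)%N -> realises S (t k)].

(** The upper half of the angles become the apex angles; [t 0] is the near angle of the first
    triangle and, for [k > 0], [t k] is the far angle of the [k]-th. The hypotheses give the
    existence of the first triangle and convexity at R_1; the rest follows from monotonicity. *)
Lemma realisable_obtuse : t 0 + t L < pi -> pi < t 0 + t 1 + t L.+1 ->
  realisable.
Proof.
move=> tL tL1.
pose a k := if k is k'.+1 then t (L + k')%N else 0.
pose c k := if k is k'.+1 then pi - (a k.+1 - a k) - t k else t 0.
have aS k : a k.+1 = t (L + k)%N by [].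
have cS k : c k.+1 = pi - (a k.+2 - a k.+1) - t k.+1 by [].
have a_lt k : (k < L)%N -> a k < a k.+1.
  by case: k => [|k] kL; [apply: t_gt0 | apply: t_mono]; lia.
have a_ltpi : a L < pi.
  by rewrite -(prednK (ltnW (ltnW L3))) aS; apply: t_ltpi; lia.
have [| |S [cardS convS real]] :=
  fan_of_angles (c := c) (ltnW (ltnW L3)) (erefl : a 0 = 0) a_lt a_ltpi.
- move=> [|k] kL; first by rewrite aS addn0 t_gt0 /=; [rewrite /a; lra | lia].
  have h1 := t_gt0 (k := k.+1) ltac:(lia).
  have h2 := t_mono (i := k.+1) (j := L + k) ltac:(lia) ltac:(lia).
  have h3 := t_ltpi (k := L + k.+1) ltac:(lia).
  by rewrite cS !aS; lra.
- move=> [|k] kL; rewrite cS !aS; first by rewrite addn0 addn1 /a /c; lra.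
  have h1 := t_mono (i := k.+1) (j := k.+2) ltac:(lia) ltac:(lia).
  have h2 := t_mono (i := L + k.+1) (j := L + k.+2) ltac:(lia) ltac:(lia).
  by rewrite cS !aS; lra.
exists S; split=> // k k2L.
have [Lk|kL] := leqP L k.
  have [+ _ _] := real (k - L)%N ltac:(lia).
  by rewrite aS subnKC.
have [_] := real k kL.
case: k {k2L} kL => [|k] kL //.
by rewrite cS subKr.
Qed.

(** The near angles are [t (L+1)], [t 1], then [t (L-1)] down to [t 2]; this decrease gives
    convexity. The hypotheses say that the first two triangles exist. *)
Lemma realisable_acute : t 0 + t L.+1 < pi -> t L + t 1 - t 0 < pi ->
  realisable.
Proof.
move=> tL1 tL.
pose a k := match k with 0 => 0 | 1 => t 0 | 2 => t L
  | k'.+1 => t (L + k')%N end.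
pose c k := match k with 0 => t L.+1 | 1 => t 1 | k => t (L.+1 - k)%N end.
have aS k : a k.+3 = t (L + k.+2)%N by [].
have cS k : c k.+2 = t (L.+1 - k.+2)%N by [].
have a2 : a 2 = t L by [].
have a_lt k : (k < L)%N -> a k < a k.+1.
  by case: k => [|[|[|k]]] kL; rewrite /a /=;
    [apply: t_gt0 | apply: t_mono..]; lia.
have a_ltpi : a L < pi.
  have [k LE] : exists k, L = k.+3 by exists (L - 3)%N; lia.
  by rewrite [X in a X]LE aS; apply: t_ltpi; lia.
have [| |S [cardS convS real]] :=
  fan_of_angles (c := c) (ltnW (ltnW L3)) (erefl : a 0 = 0) a_lt a_ltpi.
- have t1 := t_gt0 (k := 1) ltac:(lia).
  have tL1' := t_gt0 (k := L.+1) ltac:(lia).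
  move=> [|[|k]] kL; [by rewrite /a /c; lra | by rewrite a2 /a /c; lra |].
  have h1 := t_gt0 (k := L.+1 - k.+2) ltac:(lia).
  (* Hence the near angle plus [a k.+3 - a k.+2] stays below [a k.+3], which is less than pi. *)
  have h2 : t (L.+1 - k.+2)%N < a k.+2.
    by case: k kL h1 => [|k] kL h1; rewrite ?a2 ?aS; apply: t_mono; lia.
  have h3 := t_ltpi (k := L + k.+2) ltac:(lia).
  by rewrite aS cS; lra.
- move=> [|[|k]] kL; rewrite ?a2 ?cS.
  + have h := t_mono (i := 1) (j := L.+1) ltac:(lia) ltac:(lia).
    have h0 := t_gt0 (k := 0) ltac:(lia).
    by rewrite /a /c; lra.
  + have h := t_mono (i := L.+1 - 2) (j := L) ltac:(lia) ltac:(lia).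
    have h0 := t_mono (i := 0) (j := 1) ltac:(lia) ltac:(lia).
    by rewrite /a /c; lra.
  + have h := t_mono (i := L.+1 - k.+3) (j := L.+1 - k.+2)
      ltac:(lia) ltac:(lia).
    by have := a_lt k.+2 ltac:(lia); lra.
exists S; split=> // k k2L.
have [->|k0] := eqVneq k 0; first by have [] := real 0 ltac:(lia).
have [->|k1] := eqVneq k 1; first by have [] := real 1 ltac:(lia).
have [->|kL] := eqVneq k L; first by have [] := real 1 ltac:(lia); rewrite a2.
have [->|kL1] := eqVneq k L.+1; first by have [] := real 0 ltac:(lia).
move/eqP in k0; move/eqP in k1; move/eqP in kL; move/eqP in kL1.
have [Lk|Lk] := ltnP L k.
  have [+ _ _] := real (k - L)%N ltac:(lia).
  have [j ->] : exists j, k = (L + j.+2)%N by exists (k - L - 2)%N; lia.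
  by rewrite addKn aS.
have [_ + _] := real (L.+1 - k)%N ltac:(lia).
have [j jE] : exists j, (L.+1 - k)%N = j.+2 by exists (L.+1 - k - 2)%N; lia.
by rewrite jE cS -jE subKn //; lia.
Qed.


(** Here [a 1] is auxiliary, chosen to make [a 3 - a 1] equal to [t (L+1)]; likewise
    [s = t L - t (L-1)]. The far angles from the third triangle on are [t 0], ..., [t (L-3)]. *)
Lemma realisable_flat : pi <= t 0 + t L.+1 -> realisable.
Proof.
move=> tL.
pose a k := match k with 0 => 0 | 1 => t L.+2 - t L.+1 | 2 => t (L - 2)%N
  | k'.+1 => t (L + k')%N end.
pose c k := pi - (a k.+1 - a k) - t (k - 2)%N.
have aS k : a k.+3 = t (L + k.+2)%N by [].
have cS k : c k.+2 = pi - (a k.+3 - a k.+2) - t k by rewrite /c subn2.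
have a0 : a 0 = 0 by [].
have a1 : a 1 = t L.+2 - t L.+1 by [].
have a2 : a 2 = t (L - 2)%N by [].
have aL : a L = t (L + L.-1)%N.
  have [k LE] : exists k, L = k.+3 by exists (L - 3)%N; lia.
  by rewrite [X in a X]LE aS LE.
clearbody a c.
have t00 := t_gt0 (k := 0) ltac:(lia).
have tL1 := t_mono (i := L.-1) (j := L) ltac:(lia) ltac:(lia).
have tL2 := t_mono (i := L) (j := L.+1) ltac:(lia) ltac:(lia).
have tL3 := t_mono (i := L.+1) (j := L.+2) ltac:(lia) ltac:(lia).
have tLpi := t_ltpi (k := L.+2) ltac:(lia).
have tLm1 := t_mono (i := L - 2) (j := L.-1) ltac:(lia) ltac:(lia).
have tLm2 := t_mono (i := 0) (j := L - 2) ltac:(lia) ltac:(lia).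
have a3 : a 3 = t L.+2 by rewrite aS addn2.
have a_lt k : (k < L)%N -> a k < a k.+1.
  (* For [a 1 < a 2]: [a 1 < pi - t (L+1) <= t 0 < t (L-2)]. *)
  case: k => [|[|[|k]]] kL; rewrite ?aS ?a0 ?a1 ?a2 ?addn2; [lra|lra|lra|].
  by apply: t_mono; lia.
have [|||||||S [cardS convS [real1 real2 real3 real4] real]] :=
  @fan_of_angles2 R L a c (t L) (t L - t L.-1) L3 a0 a_lt.
- by rewrite aL; apply: t_ltpi; lia.
- have := t_gt0 (k := L.-1) ltac:(lia).
  by lra.
- by rewrite a1; lra.
- by rewrite a2; lra.
- move=> k kL.
  have tk0 := t_gt0 (k := k) ltac:(lia).
  have tkpi := t_ltpi (k := L + k.+2) ltac:(lia).
  have tka : t k < a k.+2.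
    by case: k kL tk0 tkpi => [|k] kL _ _; rewrite ?a2 ?aS //;
      apply: t_mono; lia.
  by rewrite cS aS; lra.
(* After cancellation this inequality at R_2 is exactly [pi <= t 0 + t (L+1)]. *)
- by rewrite cS a1 a2 a3; lra.
- move=> k kL; rewrite !cS.
  have h := t_mono (i := k) (j := k.+1) ltac:(lia) ltac:(lia).
  by have := a_lt k.+3 kL; lra.
exists S; split=> // k k2L.
have [->|kL] := eqVneq k L; first exact: real1.
have [->|kLm1] := eqVneq k L.-1; first by move: real2; rewrite subKr.
have [->|kL1] := eqVneq k L.+1; first by move: real3; rewrite a1 a3 subKr.
have [->|kLm2] := eqVneq k (L - 2)%N; first by rewrite -a2.
move/eqP in kL; move/eqP in kLm1; move/eqP in kL1; move/eqP in kLm2.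
have [Lk|Lk] := ltnP L k.
  have [+ _] := real (k - L - 2)%N ltac:(lia).
  by rewrite aS; congr (realises S (t _)); lia.
have [_ +] := real k ltac:(lia).
by rewrite cS subKr.
Qed.

Lemma realisable_sorted : realisable.
Proof.
have [tL1|tL1] := leP pi (t 0 + t L.+1); first exact: realisable_flat.
have tLL1 := t_mono (i := L) (j := L.+1) ltac:(lia) ltac:(lia).
have [tL|tL] := ltP (t L + t 1 - t 0) pi; first exact: realisable_acute.
have t00 := t_gt0 (k := 0) ltac:(lia).
(* Now [t L + t 1 - t 0 >= pi], so [t 0 + t 1 + t (L+1)] exceeds [pi + 2 t 0]. *)
by apply: realisable_obtuse; lra.
Qed.

End Cases.

(** * Padding to exactly [2 * L] angles, and conclusion *)

Lemma extend_uniq (R : realType) (N : nat) (s : seq R) :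
    uniq s -> {in s, forall x, 0 < x < pi} -> (size s <= N)%N ->
  exists s' : seq R, [/\ uniq s', {in s', forall x, 0 < x < pi},
    size s' = N & {subset s <= s'}].
Proof.
elim: N => [|N IH] us spi sN.
  by exists s; split=> //; move: sN; rewrite leqn0 => /eqP.
have [sN1|sN1] := eqVneq (size s) N.+1; first by exists s; split.
move/eqP in sN1; have [s' [us' s'pi sizes' ss']] := IH us spi ltac:(lia).
(* A value below all angles present is certainly new; halving the minimum produces one. *)
have [y y0 ys'] : exists2 y, 0 < y < pi & {in s', forall x, y < x}.
  elim: s' s'pi {us' sizes' ss'} => [_|x s' IHs xpi].
    by exists (pi / 2) => //; have := @pi_gt0 R; lra.
  have [|y ypi ys'] := IHs.
    by move=> z zs; apply: xpi; rewrite inE zs orbT.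
  have /andP[x0 _] := xpi x (mem_head _ _); case/andP: ypi => y0 ypi.
  exists (Num.min x y / 2) => [|z]; first by have [] := leP x y; lra.
  by rewrite inE => /orP[/eqP->|/ys'] ; have [] := leP x y; lra.
exists (y :: s'); split=> [|x||x xs].
- by rewrite /= us' andbT; apply/negP => /ys'; rewrite ltxx.
- by rewrite inE => /orP[/eqP->|/s'pi].
- by rewrite /= sizes'.
- by rewrite inE ss' ?orbT.
Qed.

Theorem theorem1 (R : realType) (m n : nat) (hm : (5 <= m)%N)
    (hn : (0 < n)%N) (hnm : (n <= 2 * m - 4)%N)
    (theta : 'I_n -> R) (theta_inj : injective theta)
    (theta_range : forall i : 'I_n, 0 < theta i < pi) :
  exists S : set 'rV[R]_2,
    [/\ (S #= `I_m)%card,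
        forall i : 'I_n, realises S (theta i)
      & convex_position S].
Proof.
(* Then [5 <= m] becomes [3 <= L], and [2 * m - 4] is [2 * L]. *)
have [L mL] : exists L, m = L.+2 by exists (m - 2)%N; lia.
have [||| s [us spi sizes ths]] := @extend_uniq R (2 * L) (codom theta).
- by rewrite map_inj_uniq ?enum_uniq.
- by move=> _ /codomP[i ->].
- by rewrite size_codom card_ord; lia.
have memt k : (k < 2 * L)%N -> 0 < nth 0 (sort <=%O s) k < pi.
  by move=> kL; apply: spi; rewrite -(mem_sort <=%O) mem_nth // size_sort sizes.
have [|||| S [cardS convS real]] :=
  @realisable_sorted R L (nth 0 (sort <=%O s)).
- by lia.
- by move=> k /memt /andP[].
- by move=> k /memt /andP[].
- move=> i j ij jL.
  rewrite lt_sorted_ltn_nth ?inE ?size_sort ?sizes ?sort_lt_sorted //.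
  exact: ltn_trans jL.
exists S; split; [by rewrite mL| |exact: convS].
move=> i; have : theta i \in sort <=%O s by rewrite mem_sort ths ?codom_f.
by case/(nthP 0) => k; rewrite size_sort sizes => kL <-; apply: real.
Qed.
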